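(* Let $k\ge2$ and let $X$ and $Y$ be $G$-spaces. If there exists a $G$-map $g\colon Y\to X$ with a left homotopy inverse, then $\mathrm{TC}_{k,G}^{\#}(X)\ge\mathrm{TC}_{k,G}^{\#}(Y)$ and $\mathrm{TC}_{k,G}^{\#,*}(X)\ge\mathrm{TC}_{k,G}^{\#,*}(Y)$. Furthermore, $\mathrm{TC}_{k,G}^{\#}$ and $\mathrm{TC}_{k,G}^{\#,*}$ are $G$-homotopy invariants of $G$-spaces.
   Context: $X^I$ is the space of paths $[0,1]\to X$ with the compact-open topology, and $e_{k,X}\colon X^I\to X^k$ is $e_{k,X}(\alpha)=\left(\alpha(0),\alpha(\tfrac1{k-1}),\dots,\alpha(\tfrac{k-2}{k-1}),\alpha(1)\right)$. For a $G$-space $X$: $\mathrm{TC}_{k,G}^{\#}(X)$ is the smallest $n$ such that $X^k$ has an open cover by $n$ sets which are invariant under the diagonal $G$-action and over each of which $e_{k,X}$ has a continuous (not necessarily equivariant) section; $\mathrm{TC}_{k,G}^{\#,*}(X)$ is the smallest $n$ such that $X^k$ has an open cover by $n$ sets which are invariant under the componentwise $G^k$-action and over each of which $e_{k,X}$ has a continuous section. Both are $\infty$ if no such $n$ exists. A left homotopy inverse of $g$ is a continuous map $h\colon X\to Y$ (not necessarily a $G$-map) with $h\circ g\simeq\mathrm{id}_Y$. *)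

(* Defs.v *)
From HB Require Import structures.
From mathcomp Require Import all_boot all_order all_algebra.
From mathcomp Require Import all_classical all_reals topology.
Import Order.TTheory GRing.Theory Num.Theory.
Import numFieldTopology.Exports.

Set Implicit Arguments.
Unset Strict Implicit.
Unset Printing Implicit Defensive.

Local Open Scope classical_set_scope.
Local Open Scope ring_scope.

HB.mixin Record isTopologicalGroup G of Topological G & Group G := {
  mulg_continuous : continuous (fun p : G * G => (p.1 * p.2)%g);
  invg_continuous : continuous (fun a : G => a^-1%g)
}.

#[short(type="topologicalGroupType")]
HB.structure Definition TopologicalGroup :=
  {G of Topological G & Group G & isTopologicalGroup G}.

HB.mixin Record isGSpace (G : topologicalGroupType) X of Topological X := {
  gact : G -> X -> X;
  gact1 : forall x, gact 1%g x = x;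
  gactM : forall a b x, gact (a * b)%g x = gact a (gact b x);
  gact_continuous : continuous (fun p : G * X => gact p.1 p.2)
}.

#[short(type="gSpaceType")]
HB.structure Definition GSpace (G : topologicalGroupType) :=
  {X of Topological X & isGSpace G X}.

(* The subspace [0, 1] of R, as a space in its own right. *)
Definition unit_interval (R : realType) : topologicalType :=
  set_type (`[0, 1]%classic : set R).

Section UnitInterval.
Variable R : realType.

Lemma mem_unit_interval (t : R) : 0 <= t <= 1 -> t \in (`[0, 1]%classic : set R).
Proof. by move=> t01; apply/mem_set; rewrite /= in_itv. Qed.

Definition to_unit_interval (t : R) (t01 : 0 <= t <= 1) : unit_interval R :=
  exist _ t (mem_unit_interval t01).

Definition I0 : unit_interval R :=
  @to_unit_interval 0 (introT andP (conj (lexx 0) ler01)).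

Definition I1 : unit_interval R :=
  @to_unit_interval 1 (introT andP (conj ler01 (lexx 1))).

(* For k = 1 the quotient is 0 / 0 = 0 in the library. *)
Lemma sample_time_subproof k (i : 'I_k) : 0 <= (i%:R / k.-1%:R : R) <= 1.
Proof.
rewrite divr_ge0 ?ler0n //=; case: k i => [|[|k]] i; first by case: i.
  by rewrite invr0 mulr0 ler01.
by rewrite ler_pdivrMr ?ltr0n // mul1r ler_nat -ltnS ltn_ord.
Qed.

Definition sample_time k (i : 'I_k) : unit_interval R :=
  to_unit_interval (sample_time_subproof i).

End UnitInterval.

Arguments I0 R : clear implicits.
Arguments I1 R : clear implicits.
Arguments sample_time R {k} i.

Definition path_space (R : realType) (X : topologicalType) : Type :=
  continuousType (unit_interval R) X.

HB.instance Definition _ (R : realType) (X : topologicalType) :=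
  Choice.on (path_space R X).
HB.instance Definition _ (R : realType) (X : topologicalType) :=
  Topological.copy (path_space R X)
    (@initial_topology (path_space R X)
       {compact-open, unit_interval R -> X} (fun f => f : _ -> _)).

(* X^k with the product topology *)
Definition power (k : nat) (X : topologicalType) : topologicalType :=
  {ptws 'I_k -> X}.

Definition path_eval (R : realType) (k : nat) (X : topologicalType)
    (alpha : path_space R X) : power k X :=
  fun i => (alpha : _ -> _) (sample_time R i).

Arguments path_eval {R} k {X} alpha _.

(* [set_type U] carries the subspace topology, so s is continuous on U only,
   with no extension to X^k involved. *)
Definition has_section_over (R : realType) (k : nat) (X : topologicalType)
    (U : set (power k X)) : Prop :=
  exists s : set_type U -> path_space R X,
    continuous s /\ forall u : set_type U, path_eval k (s u) = set_val u.

Definition diag_act (G : topologicalGroupType) (X : gSpaceType G) (k : nat)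
    (a : G) (x : power k X) : power k X :=
  fun i => gact a (x i).

Definition comp_act (G : topologicalGroupType) (X : gSpaceType G) (k : nat)
    (a : 'I_k -> G) (x : power k X) : power k X :=
  fun i => gact (a i) (x i).

(* For a group action this inclusion already gives act a @` U = U. *)
Definition invariant_under (A T : Type) (act : A -> T -> T) (U : set T) : Prop :=
  forall a x, U x -> U (act a x).

(* The n sets need not be distinct or nonempty; n = 0 covers only an empty X^k. *)
Definition motion_cover (R : realType) (k : nat) (X : topologicalType)
    (inv : set (power k X) -> Prop) (n : nat) : Prop :=
  exists U : 'I_n -> set (power k X),
    [/\ \bigcup_i U i = [set: power k X],
        forall i, open (U i),
        forall i, inv (U i) &
        forall i, has_section_over R (U i)].

Definition min_nat_or_infty (P : nat -> Prop) : \bar int :=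
  match pselect (exists n, `[< P n >]) with
  | left exP => ((ex_minn exP)%:Z)%:E
  | right _ => +oo%E
  end.

Definition TC_sharp (R : realType) (G : topologicalGroupType) (k : nat)
    (X : gSpaceType G) : \bar int :=
  min_nat_or_infty (motion_cover R (invariant_under (@diag_act G X k))).

Definition TC_sharp_star (R : realType) (G : topologicalGroupType) (k : nat)
    (X : gSpaceType G) : \bar int :=
  min_nat_or_infty (motion_cover R (invariant_under (@comp_act G X k))).

Definition homotopy (R : realType) (X Y : topologicalType) (f g : X -> Y)
    (H : X * unit_interval R -> Y) : Prop :=
  [/\ continuous H, forall x, H (x, I0 R) = f x & forall x, H (x, I1 R) = g x].

Definition homotopic (R : realType) (X Y : topologicalType) (f g : X -> Y) :
    Prop :=
  exists H, @homotopy R X Y f g H.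

Definition equivariant (G : topologicalGroupType) (X Y : gSpaceType G)
    (f : X -> Y) : Prop :=
  forall (a : G) (x : X), f (gact a x) = gact a (f x).

Definition is_gmap (G : topologicalGroupType) (X Y : gSpaceType G)
    (f : X -> Y) : Prop :=
  continuous f /\ equivariant f.

Definition left_homotopy_inverse (R : realType) (X Y : topologicalType)
    (g : Y -> X) (h : X -> Y) : Prop :=
  continuous h /\ homotopic R (h \o g) id.

Definition g_homotopic (R : realType) (G : topologicalGroupType)
    (X Y : gSpaceType G) (f g : X -> Y) : Prop :=
  exists2 H : X * unit_interval R -> Y, homotopy f g H &
    forall (a : G) (x : X) t, H (gact a x, t) = gact a (H (x, t)).

Definition g_homotopy_equivalent (R : realType) (G : topologicalGroupType)
    (X Y : gSpaceType G) : Prop :=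
  exists (f : X -> Y) (f' : Y -> X),
    [/\ is_gmap f, is_gmap f',
        g_homotopic R (f' \o f) id & g_homotopic R (f \o f') id].

(* Main.v *)
Require Import Defs.
From mathcomp Require Import all_boot all_order all_algebra.
From mathcomp Require Import all_classical all_reals topology.
From mathcomp Require Import normedtype.

Import Order.TTheory GRing.Theory Num.Theory.
Import numFieldNormedType.Exports.

Set Implicit Arguments.
Unset Strict Implicit.
Unset Printing Implicit Defensive.

Local Open Scope classical_set_scope.
Local Open Scope ring_scope.

(** Let g : Y -> X be a G-map, h a left homotopy inverse of g, and H a homotopy
    from h \o g to the identity.  The numerical claims reduce to one fact: if
    U is open in X^k, invariant, and has a section s of the evaluation map, then
    its preimage V under g^k : Y^k -> X^k has these three properties too.  V is
    open since g^k is continuous, and invariant since g^k commutes with both the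
    diagonal and the componentwise action.

    For the section, send y in V to the path h \o s (g^k y) of Y.  It visits
    h (g y_i), not y_i, at the i-th sample time.  The homotopy H joins these two
    points, so a detour along t |-> H (y_i, t) inserted at the i-th sample time
    repairs the path there.  Since [0, 1] is compact Hausdorff, a continuous
    family of paths is the same as a continuous map F : V * [0, 1] -> Y
    ([has_section_overP]), so that the repair is an explicit homotopy extension
    problem.  [deform_at_time] solves it at one time: F is slowed down to be
    constant near t0, and the pause is spent running along the prescribed
    homotopy and back.  The modification is confined to a small neighbourhood of
    t0, so the k sample times can be treated one after the other
    ([deform_at_sample_times]).

    A G-homotopy equivalence has a left homotopy inverse, as has its
    G-homotopy inverse, hence both inequalities and equality of the
    invariants. *)

(** * The unit interval *)

Section UnitInterval.
Variable R : realType.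
Notation I := (unit_interval R).

Definition time (t : I) : R := set_val t.

Lemma time_continuous : continuous time.
Proof. exact: initial_continuous. Qed.

Lemma time01 (t : I) : 0 <= time t <= 1.
Proof. by have := set_valP t; rewrite /= in_itv. Qed.

Lemma clamp_subproof (x : R) : 0 <= Num.min 1 (Num.max 0 x) <= 1.
Proof. by rewrite le_min ler01 le_max lexx /= ge_min lexx. Qed.

(** Retracting the line onto [0, 1] lets paths be reparametrised by plain real
    formulas, with no membership proofs to carry. *)
Definition clamp (x : R) : I := to_unit_interval (clamp_subproof x).

Lemma time_clamp x : time (clamp x) = Num.min 1 (Num.max 0 x).
Proof. by []. Qed.

Lemma time_inj : injective time.
Proof. by move=> s t /val_inj. Qed.

Lemma clamp_time t : clamp (time t) = t.
Proof.
by apply: time_inj; have /andP[t0 t1] := time01 t;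
   rewrite time_clamp (max_r t0) (min_r t1).
Qed.

Lemma clamp_le0 x : x <= 0 -> clamp x = I0 R.
Proof. by move=> x0; apply: time_inj; rewrite time_clamp (max_l x0) min_r. Qed.

Lemma clamp_ge1 x : 1 <= x -> clamp x = I1 R.
Proof.
move=> x1; apply: time_inj; rewrite time_clamp min_l //.
by rewrite le_max x1 orbT.
Qed.

Lemma clamp_continuous : continuous clamp.
Proof.
apply: continuous_comp_initial => x.
apply: (@continuous_min R R (cst 1) (fun y => Num.max 0 y) x).
  exact: cvg_cst.
by apply: (@continuous_max R R (cst 0) id x); [exact: cvg_cst | exact: cvg_id].
Qed.

Lemma unit_interval_compact : compact [set: I].
Proof.
have -> : [set: I] = clamp @` `[0, 1]%classic.
  apply/seteqP; split=> // t _; exists (time t); last exact: clamp_time.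
  by rewrite /= in_itv /= time01.
apply: continuous_compact; last exact: segment_compact.
exact/continuous_subspaceT/clamp_continuous.
Qed.

Lemma unit_interval_hausdorff : hausdorff_space I.
Proof.
move=> s t st; apply/time_inj/Rhausdorff => A B As Bt.
have [u [Au Bu]] := st _ _ (time_continuous As) (time_continuous Bt).
by exists (time u).
Qed.

Lemma unit_interval_locally_compact : locally_compact [set: I].
Proof.
move=> t _; exists setT; first exact: filterT.
by split; [exact: unit_interval_compact | exact: closedT].
Qed.

End UnitInterval.

(** * Families of paths as maps out of a product *)

Section PathSpaceExponential.
Variables (R : realType) (T X : topologicalType).
Notation I := (unit_interval R).

(** Local compactness of [0, 1] is what makes evaluation of a path jointly
    continuous in the path and the time. *)
Lemma path_space_uncurry (s : T -> path_space R X) :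
  continuous s -> continuous (fun p : T * I => (s p.1 : I -> X) p.2).
Proof.
move=> cs.
have := @continuous_uncurry T I X (fun u => s u : I -> X)
  (@unit_interval_locally_compact R) (@unit_interval_hausdorff R).
rewrite /uncurry => H p.
have -> : (fun p : T * I => (s p.1 : I -> X) p.2) =
  (fun p => let (x, y) := p in (s x : I -> X) y) by apply/funext=> -[].
apply: H.
  move=> u; apply: (@continuous_comp _ (path_space R X) {compact-open, I -> X}
    s (fun f => f : I -> X)); first exact: cs.
  exact: initial_continuous.
by move=> u; exact: cts_fun.
Qed.

Lemma path_space_curry (F : T * I -> X) :
  continuous F ->
  exists2 s : T -> path_space R X, continuous s &
    forall u t, (s u : I -> X) t = F (u, t).
Proof.
move=> cF; have [cc c1] := continuous_curry cF.
pose s u : path_space R X := mkcts (c1 u).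
exists s => //.
by apply: continuous_comp_initial; exact: cc.
Qed.

End PathSpaceExponential.

(** * Moving a family of paths at given times *)

Lemma pair_continuous (S T U : topologicalType) (f : S -> T) (g : S -> U) :
  continuous f -> continuous g -> continuous (fun x => (f x, g x)).
Proof. by move=> cf cg x; exact: (cvg_pair (cf x) (cg x)). Qed.

Lemma map_fst_continuous (S T U : topologicalType) (f : S -> T) :
  continuous f -> continuous (fun p : S * U => (f p.1, p.2)).
Proof.
move=> cf; apply: pair_continuous => p; last exact: cvg_snd.
by apply: continuous_comp; [exact: cvg_fst | exact: cf].
Qed.

Lemma continuous_if_le (R : realType) (T U : topologicalType) (c : R)
    (b : T -> R) (f g : T -> U) :
  continuous b -> continuous f -> continuous g ->
  (forall x, b x = c -> f x = g x) ->
  continuous (fun x => if b x <= c then f x else g x).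
Proof.
move=> cb cf cg fg; apply/continuous_subspace_setT.
pose A := b @^-1` [set y | y <= c]; pose B := b @^-1` [set y | c <= y].
have -> : [set: T] = A `|` B.
  apply/seteqP; split=> // x _; have [] := leP (b x) c; first by left.
  by move/ltW; right.
apply: withinU_continuous.
- exact: (closed_comp (fun x _ => cb x) (@closed_le _ c)).
- exact: (closed_comp (fun x _ => cb x) (@closed_ge _ c)).
- apply: (@subspace_eq_continuous _ _ _ f).
    by move=> x /set_mem Ax; rewrite /from_subspace [b x <= c]Ax.
  exact: (@continuous_subspaceT _ _ A f cf).
- apply: (@subspace_eq_continuous _ _ _ g).
    move=> x /set_mem Bx; rewrite /from_subspace; case: ifP => // Ax.
    apply/esym/fg; by apply/eqP; rewrite eq_le Ax.
  exact: (@continuous_subspaceT _ _ B g cg).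
Qed.

(** The homotopy extension property of the pair ([0, 1], {t0}), in parameters u,
    with a bound e on the support of the deformation.  With r the distance to
    t0 measured in units of e / 2, the path is F for 2 <= r; for 1 <= r <= 2 it
    runs through the remaining values of F ahead of schedule, so that it is at
    F (u, t0) already when r = 1; for r <= 1 it follows K, arriving at K (u, 1)
    when r = 0. *)
Lemma deform_at_time (R : realType) (T X : topologicalType)
    (t0 : unit_interval R) (e : R) (F K : T * unit_interval R -> X) :
  0 < e -> continuous F -> continuous K ->
  (forall u, K (u, I0 R) = F (u, t0)) ->
  exists F' : T * unit_interval R -> X,
    [/\ continuous F',
        forall u, F' (u, t0) = K (u, I1 R) &
        forall u t, e <= `|time t - time t0| -> F' (u, t) = F (u, t)].
Proof.
move=> e0 cF cK KF.
pose d (p : T * unit_interval R) := time p.2 - time t0.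
pose r p := 2 * `|d p| / e.
(* The factor is 0 for r <= 1 and 1 for 2 <= r, so phi is constantly t0 on the
   inner interval and the identity off the outer one. *)
pose phi p := clamp (time t0 + d p * time (clamp (r p - 1))).
have cd : continuous d.
  move=> p; apply: cvgB; last exact: cvg_cst.
  by apply: continuous_comp; [exact: cvg_snd | exact: time_continuous].
have cr : continuous r.
  move=> p; apply: cvgMl; apply: cvgMr.
  by apply: cvg_norm; exact: cd.
have cclamp (h : T * unit_interval R -> R) :
    continuous h -> continuous (fun p => clamp (h p)).
  by move=> ch p; exact: (continuous_comp (ch p) (@clamp_continuous R (h p))).
have cphi : continuous phi.
  apply: (cclamp _) => p; apply: cvgD; first exact: cvg_cst.
  apply: cvgM; first exact: cd.
  apply: (@continuous_comp _ _ _ (fun q => clamp (r q - 1)) (@time R)).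
    by apply: (cclamp _) => q; apply: cvgB; [exact: cr | exact: cvg_cst].
  exact: time_continuous.
exists (fun p => if r p <= 1 then K (p.1, clamp (1 - r p)) else F (p.1, phi p)).
split.
- apply: continuous_if_le => //.
  + have c1 : continuous (fun p => (p.1, clamp (1 - r p))).
      apply: pair_continuous; first by move=> p; exact: cvg_fst.
      by apply: (cclamp _) => q; apply: cvgB; [exact: cvg_cst | exact: cr].
    by move=> p; exact: (continuous_comp (c1 p) (cK _)).
  + have c2 : continuous (fun p => (p.1, phi p)).
      by apply: pair_continuous => // p; exact: cvg_fst.
    by move=> p; exact: (continuous_comp (c2 p) (cF _)).
  + move=> p rp1; rewrite /phi rp1 subrr clamp_le0 // KF.
    by rewrite mulr0 addr0 clamp_time.
- by move=> u; rewrite /r /d /= subrr normr0 mulr0 mul0r ler01 subr0 clamp_ge1.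
- move=> u t et /=.
  have r2 : 2 <= r (u, t) by rewrite /r ler_pdivlMr // ler_pM2l.
  rewrite ifF; last by apply/negbTE; rewrite -ltNge (lt_le_trans _ r2) ?ltr1n.
  rewrite /phi (@clamp_ge1 _ (_ - 1)) ?lerBrDr //.
  by rewrite mulr1 addrC subrK clamp_time.
Qed.

(** The sample times are 1 / (k - 1) apart, so a deformation supported within
    that distance of one of them leaves the others alone. *)
Lemma sample_time_dist (R : realType) k (i j : 'I_k) : i != j ->
  k.-1%:R^-1 <= `|time (sample_time R i) - time (sample_time R j)|.
Proof.
move=> ij; rewrite /time /= -mulrBl normrM.
rewrite [`|k.-1%:R^-1|]ger0_norm ?invr_ge0 // ler_peMl ?invr_ge0 //.
wlog lt_ij : i j ij / (j < i)%N.
  move=> H; have [/H||/val_inj eq_ij] := ltngtP j i; first exact.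
    by rewrite distrC eq_sym in ij *; exact: H.
  by rewrite eq_ij eqxx in ij.
by rewrite -natrB 1?ltnW // normr_nat ler1n subn_gt0.
Qed.

Lemma deform_at_sample_times (R : realType) (T X : topologicalType) k
    (F : T * unit_interval R -> X) (K : 'I_k -> T * unit_interval R -> X) :
  (2 <= k)%N -> continuous F -> (forall i, continuous (K i)) ->
  (forall i u, K i (u, I0 R) = F (u, sample_time R i)) ->
  exists2 F' : T * unit_interval R -> X, continuous F' &
    forall i u, F' (u, sample_time R i) = K i (u, I1 R).
Proof.
move=> k2 cF cK KF.
(* The sample times are treated in order; after n steps the later ones still
   carry the values of F. *)
suff /(_ k)[F' [cF' F'K _]] : forall n, exists F' : T * unit_interval R -> X,
    [/\ continuous F',
        forall i : 'I_k, (i < n)%N ->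
          forall u, F' (u, sample_time R i) = K i (u, I1 R) &
        forall i : 'I_k, (n <= i)%N ->
          forall u, F' (u, sample_time R i) = F (u, sample_time R i)].
  by exists F' => // i u; exact: F'K.
elim=> [|n [F' [cF' F'K F'F]]]; first by exists F.
have [nk|kn] := ltnP n k; last first.
  exists F'; split=> // i; first by move=> _; apply/F'K/leq_trans/kn.
  by move=> ni; apply/F'F/ltnW.
pose j := Ordinal nk.
have k1_gt0 : 0 < k.-1%:R^-1 :> R.
  by rewrite invr_gt0 ltr0n -ltnS prednK // ltnW.
have [u|F2 [cF2 F2j F2F']] :=
    @deform_at_time R T X (sample_time R j) _ F' (K j) k1_gt0 cF' (cK j).
  by rewrite KF F'F.
exists F2; split=> // i.
  rewrite ltnS leq_eqVlt => /orP[/eqP ij|lt_in] u.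
    by rewrite (_ : i = j) ?F2j //; exact: val_inj.
  rewrite F2F'; first exact: F'K.
  by apply/sample_time_dist; rewrite -val_eqE /= ltn_eqF.
move=> lt_ni u; rewrite F2F'; first exact/F'F/ltnW.
by apply/sample_time_dist; rewrite -val_eqE /= gtn_eqF.
Qed.

(** * Pulling back sections and covers *)

(** The exponential law for the path space turns the section problem into the
    construction of one continuous map on a product. *)
Lemma has_section_overP (R : realType) k (X : topologicalType)
    (U : set (power k X)) :
  has_section_over R U <->
  exists2 F : set_type U * unit_interval R -> X, continuous F &
    forall u i, F (u, sample_time R i) = set_val u i.
Proof.
split=> [[s [cs sU]]|[F cF FU]].
  exists (fun p => (s p.1 : unit_interval R -> X) p.2).
    exact: path_space_uncurry.
  by move=> u i; rewrite -[RHS](congr1 (@^~ i) (sU u)).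
have [s cs sF] := path_space_curry cF.
by exists s; split=> // u; apply/funext => i; rewrite -FU -sF.
Qed.

Definition power_map k (X Y : topologicalType) (g : Y -> X) (y : power k Y) :
    power k X :=
  fun i => g (y i).

Lemma coordinate_continuous k (X : topologicalType) (i : 'I_k) :
  continuous (fun x : power k X => x i).
Proof. exact: (@proj_continuous _ (fun _ : 'I_k => X)). Qed.

Lemma power_map_continuous k (X Y : topologicalType) (g : Y -> X) :
  continuous g -> continuous (@power_map k X Y g).
Proof.
move=> cg y.
have ff : Filter (power_map g @ y) by exact: (fmap_filter _ (nbhs_filter y)).
apply/cvg_sup => i.
apply: (@continuous_comp_initial _ _ _ (fun x : 'I_k -> X => x i)) => z.
exact: (continuous_comp (@coordinate_continuous k Y i z) (cg _)).
Qed.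

(** The core of the argument: h carries the given paths back to Y, and the
    homotopy from h \o g to the identity corrects them at the sample times. *)
Lemma has_section_over_preimage (R : realType) k (X Y : topologicalType)
    (g : Y -> X) (h : X -> Y) (U : set (power k X)) :
  (2 <= k)%N -> continuous g -> left_homotopy_inverse R g h ->
  has_section_over R U -> has_section_over R (@power_map k X Y g @^-1` U).
Proof.
move=> k2 cg [ch [H [cH H0 H1]]] /has_section_overP[F cF FU].
apply/has_section_overP; set V := _ @^-1` U.
have gV (v : set_type V) : power_map g (set_val v) \in U.
  by apply/mem_set; exact: (set_valP v).
pose gUV (v : set_type V) : set_type U := exist (fun x => x \in U) _ (gV v).
have cval : continuous (set_val : set_type V -> power k Y).
  exact: initial_continuous.
have cgUV : continuous gUV.
  apply: continuous_comp_initial => v.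
  exact: (continuous_comp (cval v) (@power_map_continuous k X Y g cg _)).
have ccoord i : continuous (fun v : set_type V => set_val v i).
  move=> v.
  exact: (continuous_comp (cval v) (@coordinate_continuous k Y i _)).
have := @deform_at_sample_times R (set_type V) Y k
  (fun p => h (F (gUV p.1, p.2))) (fun i p => H (set_val p.1 i, p.2)) k2.
case=> [||i v|F' cF' F'K].
- move=> p; apply: (@continuous_comp _ _ _ (F \o _) h); last exact: ch.
  exact: (continuous_comp (@map_fst_continuous _ _ _ _ cgUV p) (cF _)).
- move=> i p.
  exact: (continuous_comp (@map_fst_continuous _ _ _ _ (ccoord i) p) (cH _)).
- by rewrite /= FU H0.
- by exists F' => // v i; rewrite F'K H1.
Qed.

(** Keeping the two invariance conditions abstract treats the diagonal and the
    componentwise action at once. *)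
Lemma motion_cover_preimage (R : realType) k (X Y : topologicalType)
    (g : Y -> X) (h : X -> Y) (invX : set (power k X) -> Prop)
    (invY : set (power k Y) -> Prop) n :
  (2 <= k)%N -> continuous g -> left_homotopy_inverse R g h ->
  (forall U, invX U -> invY (@power_map k X Y g @^-1` U)) ->
  motion_cover R invX n -> motion_cover R invY n.
Proof.
move=> k2 cg gh inv [U [Ucover Uopen Uinv Usec]].
exists (fun i => @power_map k X Y g @^-1` U i); split=> [|i|i|i].
- by rewrite -preimage_bigcup Ucover preimage_setT.
- exact: (open_comp (fun y _ => @power_map_continuous k X Y g cg y)).
- exact: inv.
- exact: has_section_over_preimage gh (Usec i).
Qed.

Lemma invariant_under_preimage (A S T : Type) (actS : A -> S -> S)
    (actT : A -> T -> T) (f : S -> T) (U : set T) :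
  (forall a x, f (actS a x) = actT a (f x)) ->
  invariant_under actT U -> invariant_under actS (f @^-1` U).
Proof. by move=> fact invU a x /= Ux; rewrite fact; exact: invU. Qed.

(** * Comparing the invariants *)

Lemma min_nat_or_infty_le (P Q : nat -> Prop) :
  (forall n, Q n -> P n) -> (min_nat_or_infty P <= min_nat_or_infty Q)%E.
Proof.
move=> QP; rewrite /min_nat_or_infty.
case: (pselect (exists n, `[< Q n >])) => [exQ|_]; last by rewrite leey.
case: pselect => [exP|[]]; last first.
  by case: exQ => n /asboolP Qn; exists n; apply/asboolP/QP.
rewrite lee_fin lez_nat; case: ex_minnP => m _; apply.
by case: ex_minnP => n /asboolP Qn _; apply/asboolP/QP.
Qed.

Lemma TC_le_of_left_homotopy_inverse (R : realType) (G : topologicalGroupType)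
    k (X Y : gSpaceType G) (g : Y -> X) (h : X -> Y) :
  (2 <= k)%N -> is_gmap g -> left_homotopy_inverse R g h ->
  (TC_sharp R k Y <= TC_sharp R k X)%E /\
  (TC_sharp_star R k Y <= TC_sharp_star R k X)%E.
Proof.
move=> k2 [cg eg] gh; split; apply: min_nat_or_infty_le => n;
  apply: (motion_cover_preimage k2 cg gh) => U;
  apply: invariant_under_preimage => a y; apply/funext => i; exact: eg.
Qed.

Lemma homotopic_of_g_homotopic (R : realType) (G : topologicalGroupType)
    (X Y : gSpaceType G) (f g : X -> Y) :
  g_homotopic R f g -> homotopic R f g.
Proof. by case=> H fgH _; exists H. Qed.

Theorem theorem3p27 (R : realType) (G : topologicalGroupType) (k : nat)
    (hk : (2 <= k)%N) (X Y : gSpaceType G) :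
  ((exists g : Y -> X,
      is_gmap g /\ exists h : X -> Y, left_homotopy_inverse R g h) ->
    (TC_sharp R k X >= TC_sharp R k Y)%E /\
    (TC_sharp_star R k X >= TC_sharp_star R k Y)%E) /\
  (g_homotopy_equivalent R X Y ->
    TC_sharp R k X = TC_sharp R k Y /\
    TC_sharp_star R k X = TC_sharp_star R k Y).
Proof.
split=> [[g [gg [h gh]]]|[f [f' [gf gf' f'f ff']]]].
  exact: TC_le_of_left_homotopy_inverse gh.
have [XY XYs] : (TC_sharp R k X <= TC_sharp R k Y)%E /\
    (TC_sharp_star R k X <= TC_sharp_star R k Y)%E.
  apply: (TC_le_of_left_homotopy_inverse (g := f) (h := f')) => //.
  by split; [exact: gf'.1 | exact: homotopic_of_g_homotopic].
have [YX YXs] : (TC_sharp R k Y <= TC_sharp R k X)%E /\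
    (TC_sharp_star R k Y <= TC_sharp_star R k X)%E.
  apply: (TC_le_of_left_homotopy_inverse (g := f') (h := f)) => //.
  by split; [exact: gf.1 | exact: homotopic_of_g_homotopic].
by split; apply/eqP; rewrite eq_le ?XY ?XYs.
Qed.
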